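(* Let $\pi$ be a probability measure on $\mathbb R^d$ with positive density. Let $Q$ be an atomless proposal kernel, and let $T$ be the kernel obtained from $Q$ by Metropolis adjustment with respect to $\pi$. Let $\bar Q$ be any kernel that is reversible with respect to $\pi$ and has no atoms. Then, for every $x\in\mathbb R^d$, $$\|T_x-Q_x\|_{\rm TV}\le 2\,\|\bar Q_x-Q_x\|_{\rm TV}+\int\frac{\pi(y)\bar Q(y,x)}{\pi(x)}\,\Bigl|\frac{Q(y,x)}{\bar Q(y,x)}-1\Bigr|\,dy .$$ Consequently, for any convex increasing function $\Phi:\mathbb R_+\to\mathbb R_+$, and for $x\sim\pi$ and (conditionally on $x$) $y\sim\bar Q(x,\cdot)$, $$\mathbb E\,\Phi\bigl(\|T_x-Q_x\|_{\rm TV}\bigr)\le\frac12\,\mathbb E\,\Phi\bigl(4\,\|\bar Q_x-Q_x\|_{\rm TV}\bigr)+\frac12\,\mathbb E\,\Phi\Bigl(2\,\Bigl|\frac{Q(x,y)}{\bar Q(x,y)}-1\Bigr|\Bigr).$$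
   Context: $\pi(x)\propto\exp(-V(x))$ denotes both the probability measure and its (positive) Lebesgue density on $\mathbb R^d$. Kernels without atoms are identified with their densities with respect to Lebesgue measure: $Q(x,dy)=Q(x,y)\,dy$, $\bar Q(x,dy)=\bar Q(x,y)\,dy$, and these densities are taken to be positive so that all ratios are defined. $Q_x,T_x,\bar Q_x$ denote the probability measures $Q(x,\cdot),T(x,\cdot),\bar Q(x,\cdot)$. Reversibility of $\bar Q$ with respect to $\pi$ means $\pi(x)\bar Q(x,y)=\pi(y)\bar Q(y,x)$ for all $x,y$. Metropolis adjustment: $A(x,y)=\min\bigl\{1,\frac{\pi(y)Q(y,x)}{\pi(x)Q(x,y)}\bigr\}$ and $T(x,B)=\int_BQ(x,y)A(x,y)\,dy+\mathbf 1_B(x)\bigl(1-\int_{\mathbb R^d}Q(x,y)A(x,y)\,dy\bigr)$. Total variation distance: $\|\mu-\nu\|_{\rm TV}=\sup_B|\mu(B)-\nu(B)|$, i.e. half the $L^1$ distance of densities. Expectations of nonnegative quantities may be $+\infty$. *)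

(* Defs.v *)
From HB Require Import structures.
From mathcomp Require Import all_boot all_order all_algebra.
From mathcomp Require Import all_classical all_reals all_analysis.

Set Implicit Arguments.
Unset Strict Implicit.
Unset Printing Implicit Defensive.
Import Order.TTheory GRing.Theory Num.Theory.
Import numFieldNormedType.Exports.

Local Open Scope classical_set_scope.
Local Open Scope ring_scope.
Local Open Scope ereal_scope.

(* R^n with its Borel sigma-algebra, generated by the coordinate maps. *)
Notation euclid R n := (n.-tuple (measurableTypeR R)).

Section lebesgue_cons.
Context {R : realType} {n : nat}.

Definition tuple_cons (z : measurableTypeR R * euclid R n) : euclid R n.+1 :=
  [tuple of z.1 :: z.2].

Lemma measurable_tuple_cons : measurable_fun setT tuple_cons.
Proof. by apply: measurable_cons; [exact: measurable_fst|exact: measurable_snd]. Qed.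

Definition tuple_uncons (t : euclid R n.+1) : measurableTypeR R * euclid R n :=
  (thead t, [tuple of behead t]).

Lemma measurable_tuple_uncons : measurable_fun setT tuple_uncons.
Proof.
by apply: measurable_fun_pair; [exact: measurable_tnth|exact: measurable_behead].
Qed.

Lemma tuple_consK : cancel tuple_cons tuple_uncons.
Proof. by case=> x t; congr pair; apply/val_inj. Qed.

Lemma tuple_unconsK : cancel tuple_uncons tuple_cons.
Proof. by move=> t; apply/val_inj; case/tupleP: t. Qed.

Variable m : {sigma_finite_measure set (euclid R n) -> \bar R}.

Definition lebesgue_cons : set (euclid R n.+1) -> \bar R :=
  pushforward (@lebesgue_measure R \x m) tuple_cons.

Let mcons (A : set (euclid R n.+1)) : measurable A ->
  measurable (tuple_cons @^-1` A).
Proof. by move=> mA; rewrite -[X in measurable X]setTI; exact: measurable_tuple_cons. Qed.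

Let lebesgue_cons0 : lebesgue_cons set0 = 0.
Proof. by rewrite /lebesgue_cons /pushforward preimage_set0 measure0. Qed.

Let lebesgue_cons_ge0 A : 0 <= lebesgue_cons A.
Proof. by rewrite /lebesgue_cons /pushforward; apply: measure_ge0. Qed.

Let lebesgue_cons_sigma_additive : semi_sigma_additive lebesgue_cons.
Proof.
move=> F mF tF mUF; rewrite /lebesgue_cons /pushforward preimage_bigcup.
apply: measure_semi_sigma_additive.
- by move=> k; exact: mcons.
- apply/trivIsetP => /= i j _ _ ij; rewrite -preimage_setI.
  by move/trivIsetP : tF => /(_ _ _ _ _ ij) ->//; rewrite preimage_set0.
- by rewrite -preimage_bigcup; exact: mcons.
Qed.

HB.instance Definition _ := isMeasure.Build _ _ _
  lebesgue_cons lebesgue_cons0 lebesgue_cons_ge0 lebesgue_cons_sigma_additive.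

Let lebesgue_cons_sigma_finite : sigma_finite setT lebesgue_cons.
Proof.
have /sigma_finiteP[F [FT ndF Foo]] := sigma_finiteT (@lebesgue_measure R).
have /sigma_finiteP[G [GT ndG Goo]] := sigma_finiteT m.
exists (fun k => tuple_uncons @^-1` (F k `*` G k)).
  rewrite -preimage_bigcup (_ : \bigcup_k _ = setT) ?preimage_setT//.
  rewrite -setXTT FT GT predeqE => -[x y]; split.
    by move=> [k _ []/= ? ?]; split; exists k.
  move=> [/= [i _ Fix] [j _ Gjy]]; exists (maxn i j) => //; split.
  - by move: x Fix; exact/subsetPset/ndF/leq_maxl.
  - by move: y Gjy; exact/subsetPset/ndG/leq_maxr.
move=> k; have [mF Fk] := Foo k; have [mG Gk] := Goo k.
have mFG : measurable (F k `*` G k) by exact: measurableX.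
split; first by rewrite -[X in measurable X]setTI; exact: measurable_tuple_uncons.
rewrite /lebesgue_cons /pushforward -comp_preimage.
rewrite (_ : _ \o _ = id); last by apply/funext => z /=; exact: tuple_consK.
by rewrite preimage_id product_measure1E// lte_mul_pinfty// ge0_fin_numE.
Qed.

HB.instance Definition _ := Measure_isSigmaFinite.Build _ _ _ lebesgue_cons
  lebesgue_cons_sigma_finite.

End lebesgue_cons.

(* Lebesgue measure on R^n as the n-fold product of the one-dimensional one. *)
Fixpoint lebesgue {R : realType} (n : nat) :
    {sigma_finite_measure set (euclid R n) -> \bar R} :=
  match n with
  | 0%N => \d_([tuple] : euclid R 0)
  | k.+1 => lebesgue_cons (lebesgue k)
  end.

(* The defining property of the product: the volume of a box. *)
Lemma lebesgue_box {R : realType} (n : nat)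
    (A : 'I_n -> set (measurableTypeR R)) :
  (forall i, measurable (A i)) ->
  lebesgue n [set t | forall i, A i (tnth t i)] =
  \prod_(i < n) lebesgue_measure (A i).
Proof.
elim: n A => [|n IHn] A mA.
  rewrite big_ord0 /= diracE mem_set//; by case.
rewrite big_ord_recl -(IHn (fun i => A (lift ord0 i)))//.
rewrite -product_measure1E//; last first.
  rewrite (_ : [set t | _] = \bigcap_(i in [set: 'I_n])
    ((@tnth n (measurableTypeR R))^~ i @^-1` (A (lift ord0 i)))); last first.
    by apply/seteqP; split => [t At i _|t At i]; exact: At.
  apply: fin_bigcap_measurable => // i _.
  by rewrite -[X in measurable X]setTI; exact: measurable_tnth.
rewrite /= /lebesgue_cons /pushforward; congr (_ _).
apply/seteqP; split => [[x t] /= At|[x t] /= [Ax At] i].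
  split; first exact: (At ord0).
  by move=> i; have := At (lift ord0 i); rewrite tnthS.
by case: (unliftP ord0 i) => [j|] ->; rewrite ?tnthS.
Qed.

Section tv_dist.
Context d (T : measurableType d) (R : realType).

Definition tv_dist (mu nu : set T -> \bar R) : \bar R :=
  ereal_sup [set `|mu B - nu B| | B in measurable].

End tv_dist.

Section densities.
Context {R : realType} {n : nat}.
Local Notation E := (euclid R n).

Definition positive_density (mu : set E -> \bar R) (p : E -> R) : Prop :=
  [/\ measurable_fun setT p, (forall y, (0 < p y)%R) &
      forall B, measurable B -> mu B = \int[lebesgue n]_(y in B) (p y)%:E].

(* An atomless kernel is identified with its positive Lebesgue density; joint
   measurability of the density is part of the data. *)
Definition positive_kernel_density (Q : R.-pker E ~> E)
    (q : E -> E -> R) : Prop :=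
  [/\ measurable_fun setT (fun z : E * E => q z.1 z.2),
      (forall x y, (0 < q x y)%R) &
      forall x B, measurable B -> Q x B = \int[lebesgue n]_(y in B) (q x y)%:E].

Definition reversible (p : E -> R) (q : E -> E -> R) : Prop :=
  forall x y, (p x * q x y = p y * q y x)%R.

Definition acceptance (p : E -> R) (q : E -> E -> R) (x y : E) : R :=
  Num.min 1%R ((p y * q y x) / (p x * q x y))%R.

Definition metropolis (p : E -> R) (q : E -> E -> R) (x : E) (B : set E)
    : \bar R :=
  \int[lebesgue n]_(y in B) (q x y * acceptance p q x y)%:E +
  (\1_B x)%:E * (1 - \int[lebesgue n]_y (q x y * acceptance p q x y)%:E).

End densities.

(* K(X, .) is a regular version of the conditional law of Y given X. *)
Definition conditional_law d d1 d2 (W : measurableType d)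
    (T1 : measurableType d1) (T2 : measurableType d2) (R : realType)
    (P : probability W R) (X : {RV P >-> T1}) (Y : {RV P >-> T2})
    (K : R.-pker T1 ~> T2) : Prop :=
  forall A B, measurable A -> measurable B ->
    P (X @^-1` A `&` Y @^-1` B) = \int[P]_(w in X @^-1` A) K (X w) B.

(* Main.v *)
Require Import Defs.
From HB Require Import structures.
From mathcomp Require Import all_boot all_order all_algebra.
From mathcomp Require Import all_classical all_reals all_analysis.
From mathcomp Require Import measurable_realfun ring lra.

Set Implicit Arguments.
Unset Strict Implicit.
Unset Printing Implicit Defensive.
Import Order.TTheory GRing.Theory Num.Theory.
Import numFieldNormedType.Exports.

Local Open Scope classical_set_scope.
Local Open Scope ring_scope.
Local Open Scope ereal_scope.

(** Write [a(x,y)] for the acceptance probability and [rej(x)] for the total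
    rejected mass, the integral of [q(x,y) (1 - a(x,y))] over [y].  Metropolis
    adjustment takes the mass [q (1 - a)] away from [Q_x] and puts all of it
    back at [x]; hence every event changes by at most [rej(x)]
    ([tv_dist_lazy_le]).  The rejected density is the positive part of
    [q(x,y) - p(y) q(y,x) / p(x)].  Insert [qbar(x,y) = p(y) qbar(y,x) / p(x)]
    in this difference: it becomes [q(x,y) - qbar(x,y)] plus
    [qbar(x,y) (1 - q(y,x) / qbar(y,x))] ([rejection_le]).  The positive part of
    the first term integrates to the total variation distance between [Qbar_x]
    and [Q_x] ([tv_dist_density]), and the second one is bounded by the integrand
    of the statement.  This is the first claim, with constant 1 before the
    distance ([tv_dist_metropolis_le]).

    For the second claim, the bound reads [tau <= 2 t + I] where [I] is the mean
    of [|q(y,x) / qbar(y,x) - 1|] under [Qbar_x].  Convexity at the midpoint of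
    [4 t] and [2 I], followed by Jensen's inequality under [Qbar_x], gives for
    each [x]
      [Phi tau <= 1/2 Phi (4 t)
                  + 1/2 E_(y ~ Qbar_x) Phi (2 |q(y,x) / qbar(y,x) - 1|)]
    ([Phi_tv_dist_metropolis_le]).  Averaging over [x ~ pi] leaves an expectation
    in which [(x,y)] occurs in the wrong order; by reversibility the law
    [p(x) qbar(x,y)] of the pair is symmetric, so the two variables can be
    exchanged ([reversible_integral_swap]).

    The mean [I] may be infinite.  Jensen's inequality is therefore stated for a
    real number below the mean ([jensen_le]): when [I] is infinite, [tau] itself
    takes the place of [I]. *)

(** * Convex functions on the half-line and Jensen's inequality *)

Lemma convex_function_ineq (R : realType) (D : set R) (Phi : R -> R)
    (t u v : R) :
  convex_function D Phi -> D u -> D v -> (0 <= t <= 1)%R ->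
  (Phi (t * u + (1 - t) * v) <= t * Phi u + (1 - t) * Phi v)%R.
Proof.
move=> cPhi Du Dv /andP[t0 t1].
have := cPhi (Itv01 t0 t1) u v (mem_set Du) (mem_set Dv).
by rewrite !convRE.
Qed.

Lemma convex_slope_le (R : realType) (D : set R) (Phi : R -> R) (u s v : R) :
  convex_function D Phi -> D u -> D v -> (u < s)%R -> (s < v)%R ->
  ((Phi s - Phi u) / (s - u) <= (Phi v - Phi s) / (v - s))%R.
Proof.
move=> cPhi Du Dv us sv.
have us0 : (0 < s - u)%R by rewrite subr_gt0.
have sv0 : (0 < v - s)%R by rewrite subr_gt0.
have uv0 : (0 < v - u)%R by lra.
rewrite ler_pdivrMr// mulrAC ler_pdivlMr//.
have t01 : (0 <= (v - s) / (v - u) <= 1)%R.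
  by apply/andP; split; [apply: divr_ge0; exact: ltW|rewrite ler_pdivrMr//; lra].
have := convex_function_ineq cPhi Du Dv t01.
have -> : ((v - s) / (v - u) * u + (1 - (v - s) / (v - u)) * v = s)%R.
  by field; lra.
have -> : ((v - s) / (v - u) * Phi u + (1 - (v - s) / (v - u)) * Phi v =
   ((v - s) * Phi u + (s - u) * Phi v) / (v - u))%R by field; lra.
rewrite ler_pdivlMr//; lra.
Qed.

(** At [s > 0] the chord slopes to the left of [s] lie below those to the right,
    and their supremum is the slope wanted.  At [s = 0] there is no chord to the
    left, and monotonicity makes slope 0 work.  The inequality is arranged without
    subtraction, to be integrated in the extended reals. *)
Lemma convex_supporting_line (R : realType) (Phi : R -> R) (s : R) :
  convex_function (`[0%R, +oo[%classic : set R) Phi ->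
  {in `[0%R, +oo[ &, {homo Phi : u v / (u <= v)%R}} ->
  (0 <= s)%R ->
  exists2 c : R, (0 <= c)%R &
    forall u, (0 <= u)%R -> (Phi s + c * u <= Phi u + c * s)%R.
Proof.
move=> cPhi mPhi; rewrite le_eqVlt => /predU1P[<-|s0].
  exists 0%R => // u u0; rewrite !mul0r !addr0.
  by apply: mPhi; rewrite ?in_itv/= ?lexx ?u0.
(* The slope is the left derivative of Phi at s: the supremum of the slopes of
   the chords that end at s. *)
pose S : set R := [set r | exists u, [/\ (0 <= u)%R, (u < s)%R &
  r = ((Phi s - Phi u) / (s - u))%R]].
have D x : (0 <= x)%R -> (`[0%R, +oo[%classic : set R) x.
  by move=> x0; rewrite /= in_itv/= x0.
have Sub v : (s < v)%R -> ubound S ((Phi v - Phi s) / (v - s))%R.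
  move=> sv _ [u [u0 us ->]]; apply: (@convex_slope_le _ _ _ _ _ _ cPhi) => //.
    exact: D.
  by apply: D; lra.
have S0 : S ((Phi s - Phi 0) / (s - 0))%R by exists 0%R.
have hubS : has_ubound S.
  by exists ((Phi (s + 1) - Phi s) / (s + 1 - s))%R; apply: Sub; lra.
exists (sup S).
  apply: le_trans (ub_le_sup hubS S0); rewrite subr0 divr_ge0 ?(ltW s0)//.
  by rewrite subr_ge0; apply: mPhi; rewrite ?in_itv/= ?lexx ?(ltW s0).
move=> u u0; have [us|su|->//] := ltgtP u s.
- have : ((Phi s - Phi u) / (s - u) <= sup S)%R.
    by apply: ub_le_sup => //; exists u.
  rewrite ler_pdivrMr ?subr_gt0// => h; lra.
- have : (sup S <= (Phi u - Phi s) / (u - s))%R.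
    by apply: ge_sup; [exists ((Phi s - Phi 0) / (s - 0))%R|exact: Sub].
  rewrite ler_pdivlMr ?subr_gt0// => h; lra.
Qed.

(** Nothing is known of [Phi] on the negative half-line, so the proof replaces it
    by [Phi (max 0 r)], which is monotone, hence Borel, on the whole line. *)
Lemma measurable_comp_ge0_homo d (T : measurableType d) (R : realType)
    (Phi : R -> R) (g : T -> R) :
  {in `[0%R, +oo[ &, {homo Phi : u v / (u <= v)%R}} ->
  measurable_fun setT g -> (forall x, (0 <= g x)%R) ->
  measurable_fun setT (fun x => Phi (g x)).
Proof.
move=> mPhi mg g0.
rewrite (_ : (fun x => Phi (g x)) = (fun r => Phi (Num.max 0%R r)) \o g).
  apply: measurableT_comp => //; apply: nondecreasing_measurable => // a b ab.
  have max0 (r : R) : Num.max 0%R r \in `[0%R, +oo[.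
    by rewrite in_itv/= le_max lexx.
  by apply: mPhi => //; rewrite ge_max !le_max lexx ab orbT.
by apply/funext => x /=; rewrite max_r.
Qed.

(** Integrate the supporting line of [Phi] at [s].  The mean of [g] enters only
    through the lower bound [s], so it may be infinite. *)
Lemma jensen_le d (T : measurableType d) (R : realType)
    (mu : {measure set T -> \bar R}) (Phi : R -> R) (g : T -> R) (s : R) :
  mu setT = 1 ->
  {in `[0%R, +oo[, forall u, (0 <= Phi u)%R} ->
  convex_function (`[0%R, +oo[%classic : set R) Phi ->
  {in `[0%R, +oo[ &, {homo Phi : u v / (u <= v)%R}} ->
  measurable_fun setT g -> (forall x, (0 <= g x)%R) -> (0 <= s)%R ->
  s%:E <= \int[mu]_x (g x)%:E ->
  (Phi s)%:E <= \int[mu]_x (Phi (g x))%:E.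
Proof.
move=> mu1 Phi0 cPhi mPhi mg g0 s0 sg.
have [c c0 hc] := convex_supporting_line cPhi mPhi s0.
have mPg := measurable_comp_ge0_homo mPhi mg g0.
have Phi0' u : (0 <= u)%R -> (0 <= Phi u)%R.
  by move=> u0; apply: Phi0; rewrite in_itv/= u0.
have int_cst r : \int[mu]_x r%:E = r%:E.
  by rewrite (integral_cst mu measurableT r%:E) mu1 mule1.
have : \int[mu]_x ((Phi s)%:E + c%:E * (g x)%:E) <=
       \int[mu]_x ((Phi (g x))%:E + (c * s)%:E).
  apply: ge0_le_integral => //=.
  - by move=> x _; rewrite -EFinM -EFinD lee_fin addr_ge0 ?Phi0'// mulr_ge0.
  - apply/measurable_EFinP; apply: measurable_funD => //.
    exact: measurable_funM.
  - by apply/measurable_EFinP; exact: measurable_funD.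
  - by move=> x _; rewrite -EFinM -!EFinD lee_fin hc.
have mg' : measurable_fun setT (fun x => (g x)%:E) by exact/measurable_EFinP.
rewrite ge0_integralD//=; last 3 first.
- by move=> x _; rewrite lee_fin Phi0'.
- by move=> x _; rewrite -EFinM lee_fin mulr_ge0.
- by apply: emeasurable_funM.
rewrite ge0_integralD//=; last 3 first.
- by move=> x _; rewrite lee_fin Phi0'.
- exact/measurable_EFinP.
- by move=> x _; rewrite lee_fin mulr_ge0.
rewrite ge0_integralZl//=; last by move=> x _; rewrite lee_fin.
rewrite !int_cst => h.
rewrite -(@leeD2rE _ (c * s)%:E)//; apply: le_trans h.
by rewrite leeD2l// EFinM lee_wpmul2l// lee_fin.
Qed.

Lemma convex_le_half_double (R : realType) (Phi : R -> R) (u v t : R) :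
  convex_function (`[0%R, +oo[%classic : set R) Phi ->
  {in `[0%R, +oo[ &, {homo Phi : u v / (u <= v)%R}} ->
  (0 <= u)%R -> (0 <= v)%R -> (0 <= t)%R -> (t <= u + v)%R ->
  (Phi t <= 2^-1 * Phi (2 * u) + 2^-1 * Phi (2 * v))%R.
Proof.
move=> cPhi mPhi u0 v0 t0 tuv.
have h : (0 <= (2^-1 : R) <= 1)%R by apply/andP; split; lra.
have := @convex_function_ineq _ _ _ (2^-1)%R (2 * u)%R (2 * v)%R cPhi _ _ h.
rewrite /= !in_itv/= !mulr_ge0// => /(_ isT isT).
have -> : (2^-1 * (2 * u) + (1 - 2^-1) * (2 * v) = u + v)%R by field.
have -> : (1 - 2^-1 = 2^-1 :> R)%R by field.
by apply: le_trans; apply: mPhi; rewrite ?in_itv/= ?t0 ?addr_ge0.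
Qed.

(** * Measures given by densities *)

(** The integral of a nonnegative function is a supremum over the simple functions
    below it, so monotonicity needs no measurability.  This spares the proof
    that the total variation distance of the Metropolis kernel to its proposal
    is measurable in the starting point. *)
Lemma ge0_le_integral_nonmeasurable d (T : measurableType d) (R : realType)
    (mu : {measure set T -> \bar R}) (f g : T -> \bar R) :
  (forall x, 0 <= f x) -> (forall x, f x <= g x) ->
  \int[mu]_x f x <= \int[mu]_x g x.
Proof.
move=> f0 fg; have g0 x : 0 <= g x by exact: le_trans (fg x).
rewrite !ge0_integralTE//; apply: ge_ereal_sup => _ [h hf <-].
by apply: ereal_sup_ubound; exists h => // x; exact: le_trans (fg x).
Qed.

Section integral_density.
Import HBNNSimple.

(** The identity holds for indicators by hypothesis, hence for simple functions,
    and passes to [f] by monotone convergence on both sides. *)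
Lemma ge0_integral_density d (T : measurableType d) (R : realType)
    (nu mu : {measure set T -> \bar R}) (h : T -> R) (f : T -> \bar R) :
  measurable_fun setT h -> (forall x, (0 <= h x)%R) ->
  (forall B, measurable B -> nu B = \int[mu]_(x in B) (h x)%:E) ->
  measurable_fun setT f -> (forall x, 0 <= f x) ->
  \int[nu]_x f x = \int[mu]_x (f x * (h x)%:E).
Proof.
move=> mh h0 nuE mf f0.
have mEh : measurable_fun setT (EFin \o h) by exact/measurable_EFinP.
pose f_ := nnsfun_approx measurableT mf.
have f_cvg x : ((f_ n x)%:E @[n --> \oo]) --> f x.
  by apply: cvg_nnsfun_approx => // y _; exact: f0.
have f_nd x : {homo (fun n => (f_ n x)%:E) : n m / (n <= m)%N >-> n <= m}.
  by move=> m n mn; rewrite lee_fin; exact/lefP/nd_nnsfun_approx.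
have mf_ n : measurable_fun setT (fun x => (f_ n x)%:E).
  exact/measurable_EFinP/measurable_funP.
transitivity (limn (fun n => \int[nu]_x (f_ n x)%:E)).
  rewrite -monotone_convergence//.
  - by apply: eq_integral => y _; apply/esym/cvg_lim => //; exact: f_cvg.
  - by move=> n y _; rewrite lee_fin.
transitivity (limn (fun n => \int[mu]_x ((f_ n x)%:E * (h x)%:E))); last first.
  rewrite -monotone_convergence//.
  - apply: eq_integral => y _; apply/cvg_lim => //.
    by apply: cvgeZr => //; exact: f_cvg.
  - by move=> n; exact: emeasurable_funM.
  - by move=> n x _; rewrite mule_ge0// lee_fin.
  - by move=> x _ m n mn; rewrite lee_wpmul2r ?lee_fin//;
      exact/lefP/nd_nnsfun_approx.
congr (limn _); apply/funext => n.
transitivity (\sum_(k \in range (f_ n))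
    \int[nu]_x (k * \1_(f_ n @^-1` [set k]) x)%:E).
  under eq_integral do rewrite fimfunE -fsumEFin//.
  rewrite ge0_integral_fsum//.
  - by move=> y; exact/measurable_EFinP/measurable_funM.
  - by move=> y x _; rewrite nnfun_muleindic_ge0.
transitivity (\sum_(k \in range (f_ n))
    \int[mu]_x ((k * \1_(f_ n @^-1` [set k]) x)%:E * (h x)%:E)); last first.
  rewrite -ge0_integral_fsum//.
  - apply: eq_integral => x _; rewrite fimfunE -fsumEFin//.
    rewrite ge0_mule_fsuml//.
    by move=> r; rewrite EFinM nnfun_muleindic_ge0.
  - move=> y; apply: emeasurable_funM => //.
    exact/measurable_EFinP/measurable_funM.
  - move=> y x _; apply: mule_ge0; last by rewrite lee_fin.
    by rewrite EFinM nnfun_muleindic_ge0.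
apply: eq_fsbigr => r /[!inE] -[t _ <-].
have ft0 : (0 <= f_ n t)%R by [].
rewrite integralZl_indic_nnsfun// integral_indic// setIT nuE//.
under [RHS]eq_integral do rewrite EFinM -muleA.
rewrite ge0_integralZl//.
- congr (_ * _); rewrite integral_mkcond; apply: eq_integral => x _.
  by rewrite patchE indicE; case: (x \in _); rewrite ?mul1e ?mul0e.
- by apply: emeasurable_funM => //; exact/measurable_EFinP.
- by move=> x _; rewrite mule_ge0// lee_fin.
Qed.

End integral_density.

Section density_measure.
Context d (T : measurableType d) (R : realType)
  (mu : {measure set T -> \bar R}) (h : T -> R).
Context (mh : measurable_fun setT h) (h0 : forall x, (0 <= h x)%R).

(** The proof arguments let the measure structure be inferred from the term. *)
Definition density_measure of measurable_fun setT h & (forall x, (0 <= h x)%R) :=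
  fun B : set T => \int[mu]_(x in B) (h x)%:E.

Local Notation nu := (density_measure mh h0).

Let nu0 : nu set0 = 0. Proof. exact: integral_set0. Qed.

Let nu_ge0 B : 0 <= nu B. Proof. by apply: integral_ge0 => x _; rewrite lee_fin. Qed.

Let nu_sigma_additive : semi_sigma_additive nu.
Proof.
by apply: semi_sigma_additive_nng_induced => //; exact/measurable_EFinP.
Qed.

HB.instance Definition _ := isMeasure.Build _ _ _ nu nu0 nu_ge0 nu_sigma_additive.

End density_measure.

(** Rectangles are stable under intersection and generate the product
    sigma-algebra; one of them is the whole space, whose mass is finite. *)
Lemma eq_measure_rectangles d1 d2 (T1 : measurableType d1)
    (T2 : measurableType d2) (R : realType)
    (nu nu' : {measure set (T1 * T2) -> \bar R}) :
  nu setT < +oo ->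
  (forall A B, measurable A -> measurable B -> nu (A `*` B) = nu' (A `*` B)) ->
  forall C, measurable C -> nu C = nu' C.
Proof.
move=> nufin nuE C mC.
apply: (measure_unique
  [set A `*` B | A in measurable & B in measurable] (fun=> setT)) => //.
- exact: measurable_prod_measurableType.
- move=> _ _ [A1 mA1 [B1 mB1 <-]] [A2 mA2 [B2 mB2 <-]].
  rewrite -setXI; exists (A1 `&` A2); first exact: measurableI.
  by exists (B1 `&` B2) => //; exact: measurableI.
- by move=> _; exists setT => //; exists setT => //; rewrite setXTT.
- by rewrite bigcup_const//; exists 0%N.
- by move=> _ [A mA [B mB <-]]; exact: nuE.
Qed.

(** The law of [(X, Y)] has density [p x * k x y]: both measures give the same
    mass to every rectangle, by the definition of a conditional law. *)
Lemma ge0_integral_joint_density dW d1 d2 (W : measurableType dW)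
    (T1 : measurableType d1) (T2 : measurableType d2) (R : realType)
    (m1 : {sigma_finite_measure set T1 -> \bar R})
    (m2 : {sigma_finite_measure set T2 -> \bar R})
    (P : probability W R) (X : {RV P >-> T1}) (Y : {RV P >-> T2})
    (K : R.-pker T1 ~> T2) (p : T1 -> R) (k : T1 -> T2 -> R)
    (f : T1 * T2 -> \bar R) :
  measurable_fun setT p -> (forall x, (0 <= p x)%R) ->
  (forall A, measurable A -> distribution P X A = \int[m1]_(x in A) (p x)%:E) ->
  measurable_fun setT (fun z : T1 * T2 => k z.1 z.2) ->
  (forall x y, (0 <= k x y)%R) ->
  (forall x B, measurable B -> K x B = \int[m2]_(y in B) (k x y)%:E) ->
  conditional_law X Y K ->
  measurable_fun setT f -> (forall z, 0 <= f z) ->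
  \int[P]_w f (X w, Y w) =
    \int[m1]_x \int[m2]_y (f (x, y) * (p x * k x y)%:E).
Proof.
move=> mp p0 pE mk k0 kE XYK mf f0.
pose h (z : T1 * T2) : R := (p z.1 * k z.1 z.2)%R.
have mh : measurable_fun setT h.
  by apply: measurable_funM => //; exact: measurableT_comp.
have h0 z : (0 <= h z)%R by rewrite mulr_ge0.
have mXY : measurable_fun setT (fun w => (X w, Y w)).
  exact: measurable_fun_pair.
pose XYmixin := isMeasurableFun.Build _ _ _ _ _ mXY.
pose XY : {RV P >-> (T1 * T2)%type} := HB.pack (fun w => (X w, Y w)) XYmixin.
have mK B : measurable B -> measurable_fun setT (fun x => K x B).
  by move=> mB; exact: measurable_kernel.
have rectangles A B : measurable A -> measurable B ->
    distribution P XY (A `*` B) =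
    @density_measure _ _ _ (m1 \x m2) _ mh h0 (A `*` B).
  move=> mA mB.
  transitivity (P (X @^-1` A `&` Y @^-1` B)); first by [].
  rewrite XYK//.
  transitivity (\int[distribution P X]_(x in A) K x B).
    rewrite ge0_integral_pushforward//.
    by apply: measurable_funTS; exact: mK.
  rewrite integral_mkcond.
  rewrite (ge0_integral_density (mu := m1) (h := p))//; last 2 first.
  - apply/(measurable_restrictT _ _).1 => //.
    by apply: measurable_funTS; exact: mK.
  - by move=> x; apply: erestrict_ge0 => ? _.
  rewrite /density_measure [RHS]integral_mkcond fubini_tonelli1//=; last 2 first.
  - apply/(measurable_restrictT _ _).1; first exact: measurableX.
    by apply: measurable_funTS; exact/measurable_EFinP.
  - by move=> z; apply: erestrict_ge0 => ? _; rewrite lee_fin.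
  apply: eq_integral => x _; rewrite /fubini_F patchE; case: ifPn => xA.
  - rewrite kE// muleC -ge0_integralZl//=; last 3 first.
    + apply: measurable_funTS; apply/measurable_EFinP.
      exact: (measurable_fun_pair2 x mk).
    + by move=> y _; rewrite lee_fin.
    + by rewrite lee_fin.
    rewrite integral_mkcond; apply: eq_integral => y _; rewrite !patchE.
    by rewrite in_setX/= xA.
  - rewrite mul0e integral0_eq// => y _; rewrite patchE in_setX/=.
    by rewrite (negbTE xA).
have law C : measurable C ->
    distribution P XY C = \int[m1 \x m2]_(z in C) (h z)%:E.
  move=> mC; rewrite -[RHS]/(@density_measure _ _ _ (m1 \x m2) _ mh h0 C).
  apply: eq_measure_rectangles => //.
  by rewrite -[ltLHS]/(distribution P XY setT) probability_setT ltry.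
transitivity (\int[distribution P XY]_z f z).
  by rewrite ge0_integral_distribution.
rewrite (ge0_integral_density (mu := m1 \x m2) (h := h))//.
rewrite fubini_tonelli1//.
- by apply: emeasurable_funM => //; exact/measurable_EFinP.
- by move=> z; rewrite mule_ge0// lee_fin.
Qed.

(** * Total variation distance *)

Lemma tv_dist_ge0 d (T : measurableType d) (R : realType)
    (mu nu : set T -> \bar R) : 0 <= tv_dist mu nu.
Proof.
apply: (@le_trans _ _ `|mu set0 - nu set0|) => //.
by apply: ereal_sup_ubound; exists set0.
Qed.

(** Two densities of equal total mass have [f]-excess equal to [g]-excess, so on
    an event the difference of the measures is a difference of two numbers
    between 0 and this common value, and it is attained where [f < g]. *)
Lemma tv_dist_density d (T : measurableType d) (R : realType)
    (m mu nu : {measure set T -> \bar R}) (f g : T -> R) :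
  measurable_fun setT f -> measurable_fun setT g ->
  (forall x, (0 <= f x)%R) -> (forall x, (0 <= g x)%R) ->
  (forall B, measurable B -> mu B = \int[m]_(x in B) (f x)%:E) ->
  (forall B, measurable B -> nu B = \int[m]_(x in B) (g x)%:E) ->
  mu setT = nu setT -> nu setT < +oo ->
  tv_dist mu nu = \int[m]_x (Num.max 0 (g x - f x))%:E.
Proof.
move=> mf mg f0 g0 muE nuE mu_nu nufin.
(* [up u v B] is the mass on B of the positive part of v - u. *)
pose up (u v : T -> R) B := \int[m]_(x in B) (Num.max 0 (v x - u x))%:E.
have mup (u v : T -> R) : measurable_fun setT u -> measurable_fun setT v ->
    measurable_fun setT (fun x => (Num.max 0 (v x - u x))%:E).
  move=> mu_ mv_; apply/measurable_EFinP; apply: measurable_maxr => //.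
  exact: measurable_funB.
have up0 (u v : T -> R) x : (0 <= Num.max 0 (v x - u x))%R.
  by rewrite le_max lexx.
have up_ge0 (u v : T -> R) B : 0 <= up u v B.
  by apply: integral_ge0 => x _; rewrite lee_fin; exact: up0.
have upS (u v : T -> R) B : measurable_fun setT u -> measurable_fun setT v ->
    measurable B -> up u v B <= up u v setT.
  move=> mu_ mv_ mB; apply: ge0_subset_integral => //; first exact: mup.
  by move=> x _; rewrite lee_fin; exact: up0.
have balance B : measurable B -> mu B + up f g B = nu B + up g f B.
  move=> mB; rewrite muE// nuE// /up -!ge0_integralD//=.
  - apply: eq_integral => x _; rewrite -!EFinD; congr (_%:E).
    have [fg|gf] := leP (f x) (g x).
      rewrite max_r; last lra.
      rewrite max_l; lra.
    rewrite max_l; last lra.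
    rewrite max_r; lra.
  - by move=> x _; rewrite lee_fin.
  - by apply: measurable_funTS; exact/measurable_EFinP.
  - by move=> x _; rewrite lee_fin; exact: up0.
  - by apply: measurable_funTS; exact: mup.
  - by move=> x _; rewrite lee_fin.
  - by apply: measurable_funTS; exact/measurable_EFinP.
  - by move=> x _; rewrite lee_fin; exact: up0.
  - by apply: measurable_funTS; exact: mup.
have up_fin : up f g setT \is a fin_num.
  rewrite ge0_fin_numE//.
  apply: le_lt_trans nufin; rewrite nuE//; apply: ge0_le_integral => //.
  - by move=> x _; rewrite lee_fin; exact: up0.
  - exact: mup.
  - exact/measurable_EFinP.
  - by move=> x _; rewrite lee_fin ge_max g0/=; have := f0 x; lra.
have upE : up g f setT = up f g setT.
  have := balance _ measurableT; rewrite mu_nu => /(congr1 (fun z => z - nu setT)).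
  by rewrite ![nu setT + _]addeC !addeK// ge0_fin_numE.
have fin_mu B : measurable B -> mu B \is a fin_num.
  move=> mB; rewrite ge0_fin_numE//; apply: le_lt_trans nufin.
  by rewrite -mu_nu; apply: le_measure; rewrite ?inE.
have fin_nu B : measurable B -> nu B \is a fin_num.
  move=> mB; rewrite ge0_fin_numE//; apply: le_lt_trans nufin.
  by apply: le_measure; rewrite ?inE.
have fin_up (u v : T -> R) B : up u v B <= up f g setT -> up u v B \is a fin_num.
  by move=> le; rewrite ge0_fin_numE// (le_lt_trans le)// -ge0_fin_numE.
have diffE B : measurable B -> mu B - nu B = up g f B - up f g B.
  move=> mB; have := balance _ mB.
  have fgB : up f g B \is a fin_num by apply: fin_up; exact: upS.
  have gfB : up g f B \is a fin_num by apply: fin_up; rewrite -upE; exact: upS.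
  rewrite -(fineK fgB) -(fineK gfB) -(fineK (fin_mu _ mB)) -(fineK (fin_nu _ mB)).
  rewrite -!EFinB -!EFinD => -[e]; congr (_%:E); lra.
apply/eqP; rewrite eq_le; apply/andP; split.
  apply: ge_ereal_sup => _ [B mB <-]; rewrite diffE//.
  have le1 : up f g B <= up f g setT by exact: upS.
  have le2 : up g f B <= up f g setT by rewrite -upE; exact: upS.
  rewrite -/(up f g setT).
  move: (up_ge0 f g B) (up_ge0 g f B) (le1) (le2).
  rewrite -(fineK up_fin) -(fineK (fin_up _ _ _ le1)) -(fineK (fin_up _ _ _ le2)).
  rewrite -EFinB abse_EFin !lee_fin => *.
  by rewrite ler_norml; apply/andP; split; lra.
pose B := [set x | (f x < g x)%R].
have mB : measurable B.
  rewrite (_ : B = (fun x => f x < g x)%R @^-1` [set true]); last by [].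
  by rewrite -[X in measurable X]setTI; exact: measurable_fun_ltr.
have -> : \int[m]_x (Num.max 0 (g x - f x))%:E = `|mu B - nu B|.
  rewrite diffE// (_ : up g f B = 0).
    rewrite sub0e abseN gee0_abs//.
    rewrite /up [RHS]integral_mkcond; apply: eq_integral => x _.
    rewrite patchE; case: ifPn => //; rewrite notin_setE /B/= => /negP.
    by rewrite -leNgt => gf; rewrite max_l// subr_le0.
  apply: integral0_eq => x /= fg; rewrite max_l// subr_le0; exact: ltW.
by apply: ereal_sup_ubound; exists B.
Qed.

(** A sub-density [a] of [g] completed to total mass 1 by an atom at [x].  The
    change on an event is the full removed mass, if the event contains [x], minus
    the mass removed from the event: it lies between plus and minus the removed
    mass. *)
Lemma tv_dist_lazy_le d (T : measurableType d) (R : realType)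
    (m nu : {measure set T -> \bar R}) (a g : T -> R) (x : T) :
  measurable_fun setT a -> measurable_fun setT g ->
  (forall y, (0 <= a y <= g y)%R) ->
  (forall B, measurable B -> nu B = \int[m]_(y in B) (g y)%:E) ->
  nu setT = 1 ->
  tv_dist (fun B => \int[m]_(y in B) (a y)%:E +
      (\1_B x)%:E * (1 - \int[m]_y (a y)%:E)) nu
    <= \int[m]_y (g y - a y)%:E.
Proof.
move=> ma mg ag nuE nu1.
have a0 y : (0 <= a y)%R by have /andP[] := ag y.
have ga0 y : (0 <= g y - a y)%R by rewrite subr_ge0; have /andP[] := ag y.
pose rej B := \int[m]_(y in B) (g y - a y)%:E.
pose acc B := \int[m]_(y in B) (a y)%:E.
have acc0 B : 0 <= acc B by apply: integral_ge0 => y _; rewrite lee_fin.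
have rej0 B : 0 <= rej B by apply: integral_ge0 => y _; rewrite lee_fin.
have mga : measurable_fun setT (fun y => (g y - a y)%:E).
  by apply/measurable_EFinP; exact: measurable_funB.
have split_nu B : measurable B -> nu B = acc B + rej B.
  move=> mB; rewrite nuE// /acc /rej -ge0_integralD//=.
  - by apply: eq_integral => y _; rewrite -EFinD addrC subrK.
  - by move=> y _; rewrite lee_fin.
  - by apply: measurable_funTS; exact/measurable_EFinP.
  - by move=> y _; rewrite lee_fin.
  - exact: measurable_funTS.
have nu_fin B : measurable B -> nu B < +oo.
  move=> mB; apply: (@le_lt_trans _ _ (nu setT)); last by rewrite nu1 ltry.
  by apply: le_measure; rewrite ?inE.
have acc_fin B : measurable B -> acc B \is a fin_num.
  move=> mB; rewrite ge0_fin_numE//; apply: le_lt_trans (nu_fin _ mB).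
  by rewrite split_nu// leeDl.
have rej_fin B : measurable B -> rej B \is a fin_num.
  move=> mB; rewrite ge0_fin_numE//; apply: le_lt_trans (nu_fin _ mB).
  by rewrite split_nu// leeDr.
have rejS B : measurable B -> rej B <= rej setT.
  move=> mB; apply: ge0_subset_integral => // y _; by rewrite lee_fin.
apply: ge_ereal_sup => _ [B mB <-].
rewrite split_nu// -/(acc B) -/(acc setT) -/(rej setT).
have total : acc setT + rej setT = 1 by rewrite -split_nu.
move: total (rej0 B) (rejS B mB) => /=.
rewrite -(fineK (acc_fin _ mB)) -(fineK (rej_fin _ mB)).
rewrite -(fineK (acc_fin _ measurableT)) -(fineK (rej_fin _ measurableT)).
rewrite -!EFinD => -[total] /=.
rewrite !lee_fin => rB0 rBle.
rewrite indicE; case: (x \in B) => /=; rewrite ?mul1r ?mul0r ler_norml;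
  apply/andP; split; lra.
Qed.

(** * The Metropolis kernel *)

Lemma measurable_fun_inv_gt0 d (T : measurableType d) (R : realType) (f : T -> R) :
  measurable_fun setT f -> (forall x, (0 < f x)%R) ->
  measurable_fun setT (fun x => (f x)^-1%R).
Proof.
move=> mf f0.
rewrite (_ : (fun x => _) = (@powR R ^~ (-1)%R) \o f).
  by apply: measurableT_comp => //; exact: measurable_powR.
by apply/funext => x /=; rewrite powR_inv1// ltW.
Qed.

(** The pointwise form of the first claim: [bxy] and [byx] stand for the values
    [qbar x y] and [qbar y x], and reversibility turns the weight
    [py * byx / px] into [bxy]. *)
Lemma rejection_le (R : realType) (px py qxy qyx bxy byx : R) :
  (0 < px)%R -> (0 < qxy)%R -> (0 < bxy)%R -> (0 < byx)%R ->
  (px * bxy = py * byx)%R ->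
  (qxy - qxy * Num.min 1 (py * qyx / (px * qxy)) <=
    Num.max 0 (qxy - bxy) + py * byx / px * `|qyx / byx - 1|)%R.
Proof.
move=> px0 qxy0 bxy0 byx0 rev.
have bE : (py * byx / px = bxy)%R by rewrite -rev; field; lra.
have -> : (py * qyx / (px * qxy) = bxy * (qyx / byx) / qxy)%R.
  by rewrite -bE; field; lra.
rewrite bE; set r := (qyx / byx)%R.
have r1 : (bxy * (1 - r) <= bxy * `|r - 1|)%R.
  by rewrite ler_pM2l// distrC ler_norm.
have r2 : (0 <= bxy * `|r - 1|)%R by rewrite mulr_ge0// ltW.
have max1 : (0 <= Num.max 0 (qxy - bxy))%R by rewrite le_max lexx.
have max2 : (qxy - bxy <= Num.max 0 (qxy - bxy))%R by rewrite le_max lexx orbT.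
have [_|_] := leP 1%R (bxy * r / qxy)%R; first lra.
have -> : (qxy * (bxy * r / qxy) = bxy * r)%R by field; lra.
lra.
Qed.

Section metropolis.
Context {R : realType} {d : nat}.
Local Notation E := (euclid R d).
Implicit Types (p : E -> R) (q qbar : E -> E -> R).

Lemma measurable_ratio q qbar :
  measurable_fun setT (fun z : E * E => q z.1 z.2) ->
  measurable_fun setT (fun z : E * E => qbar z.1 z.2) ->
  (forall x y, (0 < qbar x y)%R) ->
  measurable_fun setT (fun z : E * E => `|q z.1 z.2 / qbar z.1 z.2 - 1|%R).
Proof.
move=> mq mqbar qbar0.
apply: measurableT_comp => //; apply: measurable_funB => //.
apply: measurable_funM => //; exact: measurable_fun_inv_gt0.
Qed.

Lemma tv_dist_kernel_density (Q Qbar : R.-pker E ~> E) q qbar x :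
  positive_kernel_density Q q -> positive_kernel_density Qbar qbar ->
  tv_dist (Qbar x) (Q x) =
    \int[lebesgue d]_y (Num.max 0 (q x y - qbar x y))%:E.
Proof.
move=> [mq q0 QE] [mqbar qbar0 QbarE]; apply: tv_dist_density.
- exact: (measurable_fun_pair2 x mqbar).
- exact: (measurable_fun_pair2 x mq).
- by move=> y; exact: ltW.
- by move=> y; exact: ltW.
- exact: QbarE.
- exact: QE.
- by rewrite !prob_kernel.
- by rewrite prob_kernel ltry.
Qed.

Lemma tv_dist_kernel_fin_num (Q Qbar : R.-pker E ~> E) q qbar x :
  positive_kernel_density Q q -> positive_kernel_density Qbar qbar ->
  tv_dist (Qbar x) (Q x) \is a fin_num.
Proof.
move=> hQ hQbar; have [mq q0 QE] := hQ; have [mqbar qbar0 QbarE] := hQbar.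
rewrite ge0_fin_numE ?tv_dist_ge0// (tv_dist_kernel_density x hQ hQbar).
apply: (@le_lt_trans _ _ (Q x setT)); last by rewrite prob_kernel ltry.
rewrite QE//; apply: ge0_le_integral_nonmeasurable => y.
  by rewrite lee_fin le_max lexx.
by rewrite lee_fin ge_max (ltW (q0 x y))/= gerBl ltW.
Qed.

(** A supremum over all measurable sets has no reason to be measurable in [x];
    the integral formula for the distance gives it by Tonelli. *)
Lemma measurable_tv_dist_kernel (Q Qbar : R.-pker E ~> E) q qbar :
  positive_kernel_density Q q -> positive_kernel_density Qbar qbar ->
  measurable_fun setT (fun x => fine (tv_dist (Qbar x) (Q x))).
Proof.
move=> hQ hQbar; have [mq q0 QE] := hQ; have [mqbar qbar0 QbarE] := hQbar.
apply: measurableT_comp => //.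
rewrite (_ : (fun x => _) = fubini_F (lebesgue d)
    (fun z => (Num.max 0 (q z.1 z.2 - qbar z.1 z.2))%:E)); last first.
  by apply/funext => x; rewrite (tv_dist_kernel_density x hQ hQbar).
apply: measurable_fun_fubini_tonelli_F => [|z].
  apply/measurable_EFinP; apply: measurable_maxr => //.
  exact: measurable_funB.
by rewrite lee_fin le_max lexx.
Qed.

Lemma tv_dist_metropolis_le (pi : probability E R) p (Q Qbar : R.-pker E ~> E)
    q qbar (x : E) :
  positive_density pi p -> positive_kernel_density Q q ->
  positive_kernel_density Qbar qbar -> reversible p qbar ->
  tv_dist (metropolis p q x) (Q x) <=
    tv_dist (Qbar x) (Q x) +
    \int[lebesgue d]_y (p y * qbar y x / p x * `|q y x / qbar y x - 1|)%:E.
Proof.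
move=> [mp p0 _] hQ hQbar rev.
have [mq q0 QE] := hQ; have [mqbar qbar0 QbarE] := hQbar.
have mqx := measurable_fun_pair2 x mq; have mqy := measurable_fun_pair1 x mq.
have mbx := measurable_fun_pair2 x mqbar.
have mby := measurable_fun_pair1 x mqbar.
rewrite /= in mqx mqy mbx mby.
have macc : measurable_fun setT (fun y => q x y * acceptance p q x y)%R.
  apply: measurable_funM => //; apply: measurable_minr => //.
  apply: measurable_funM; first exact: measurable_funM.
  apply: measurable_fun_inv_gt0; first exact: measurable_funM.
  by move=> y; rewrite mulr_gt0.
have acc01 y : (0 <= acceptance p q x y <= 1)%R.
  rewrite /acceptance ge_min lexx/= andbT le_min ler01/=.
  by rewrite divr_ge0// mulr_ge0// ltW.
have Qx1 : Q x setT = 1 by exact: prob_kernel.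
have accq y : (0 <= q x y * acceptance p q x y <= q x y)%R.
  have /andP[a0 a1] := acc01 y.
  by rewrite mulr_ge0 ?(ltW (q0 x y))//= ler_piMr// ltW.
apply: (le_trans (tv_dist_lazy_le x macc mqx accq (QE x) Qx1)).
rewrite (tv_dist_kernel_density x hQ hQbar).
have mw : measurable_fun setT
    (fun y => p y * qbar y x / p x * `|q y x / qbar y x - 1|)%R.
  apply: measurable_funM.
    by apply: measurable_funM => //; exact: measurable_funM.
  exact: (measurable_fun_pair1 x (measurable_ratio mq mqbar qbar0)).
have w0 y : (0 <= p y * qbar y x / p x * `|q y x / qbar y x - 1|)%R.
  by rewrite mulr_ge0// divr_ge0 ?mulr_ge0// ltW.
have mmax : measurable_fun setT (fun y => Num.max 0 (q x y - qbar x y))%R.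
  by apply: measurable_maxr => //; exact: measurable_funB.
rewrite -ge0_integralD//; first last.
- exact/measurable_EFinP.
- by move=> y _; rewrite lee_fin.
- exact/measurable_EFinP.
- by move=> y _; rewrite lee_fin le_max lexx.
apply: ge0_le_integral_nonmeasurable => y.
  by rewrite lee_fin subr_ge0; have /andP[] := accq y.
by rewrite -EFinD lee_fin; apply: rejection_le.
Qed.

(** Given [X = x], the value [x] plays the role of the second variable on the left
    and of the first one on the right: under [p x * qbar x y] the pair is
    exchangeable. *)
Lemma reversible_integral_swap (pi : probability E R) p (Qbar : R.-pker E ~> E)
    qbar (dW : measure_display) (W : measurableType dW) (P : probability W R)
    (X Y : {RV P >-> E}) (f : E * E -> \bar R) :
  positive_density pi p -> positive_kernel_density Qbar qbar ->
  reversible p qbar ->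
  (forall B, measurable B -> distribution P X B = pi B) ->
  conditional_law X Y Qbar ->
  measurable_fun setT f -> (forall z, 0 <= f z) ->
  \int[P]_w \int[Qbar (X w)]_y f (y, X w) = \int[P]_w f (X w, Y w).
Proof.
move=> [mp p0 piE] [mqbar qbar0 QbarE] rev Xpi XYQ mf f0.
have mfswap : measurable_fun setT (fun z : E * E => f (z.2, z.1)).
  apply: (@measurableT_comp _ _ _ _ _ _ f setT (fun z => (z.2, z.1)) mf).
  exact: measurable_fun_pair.
pose J x := \int[lebesgue d]_y (f (y, x) * (qbar x y)%:E).
have mJint : measurable_fun setT
    (fun z : E * E => f (z.2, z.1) * (qbar z.1 z.2)%:E).
  by apply: emeasurable_funM => //; exact/measurable_EFinP.
have Jint0 (z : E * E) : 0 <= f (z.2, z.1) * (qbar z.1 z.2)%:E.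
  by rewrite mule_ge0// lee_fin ltW.
have mJ : measurable_fun setT J.
  exact: (measurable_fun_fubini_tonelli_F _ mJint Jint0).
have J0 x : 0 <= J x by apply: integral_ge0 => y _; exact: (Jint0 (x, y)).
have JE x : J x = \int[Qbar x]_y f (y, x).
  rewrite /J (@ge0_integral_density _ _ _ (Qbar x) (lebesgue d) (qbar x))//.
  - exact: (measurable_fun_pair2 x mqbar).
  - by move=> y; exact: ltW.
  - exact: QbarE.
  - exact: (measurable_fun_pair1 x mf).
under eq_integral do rewrite -JE.
transitivity (\int[lebesgue d]_x (J x * (p x)%:E)).
  transitivity (\int[distribution P X]_x J x).
    by rewrite ge0_integral_distribution.
  apply: ge0_integral_density => //; first by move=> x; exact: ltW.
  by move=> B mB; rewrite -piE// -Xpi.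
rewrite (@ge0_integral_joint_density _ _ _ _ _ _ _ (lebesgue d) (lebesgue d)
   P X Y Qbar p qbar f)//; last first.
- by move=> x y; exact: ltW.
- by move=> B mB; rewrite -piE// -Xpi.
- by move=> x; exact: ltW.
rewrite (@fubini_tonelli _ _ _ _ _ (lebesgue d) (lebesgue d)
   (fun z => f z * (p z.1 * qbar z.1 z.2)%:E))//; last first.
- by move=> z; rewrite mule_ge0// lee_fin mulr_ge0// ltW.
- apply: emeasurable_funM => //; apply/measurable_EFinP.
  by apply: measurable_funM => //; exact: measurableT_comp.
apply: eq_integral => x _; rewrite -ge0_integralZr//; last 3 first.
- exact: (measurable_fun_pair2 x mJint).
- by move=> y _; exact: (Jint0 (x, y)).
- by rewrite lee_fin ltW.
by apply: eq_integral => y _; rewrite -muleA -EFinM/= -rev [(p x * _)%R]mulrC.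
Qed.

(** The two terms of the bound on the distance are separated by convexity at the
    midpoint, at the price of a factor 2 inside [Phi]; the integral term then goes
    through Jensen's inequality under [Qbar x]. *)
Lemma Phi_tv_dist_metropolis_le (pi : probability E R) p
    (Q Qbar : R.-pker E ~> E) q qbar (Phi : R -> R) (x : E) :
  positive_density pi p -> positive_kernel_density Q q ->
  positive_kernel_density Qbar qbar -> reversible p qbar ->
  {in `[0%R, +oo[, forall s, (0 <= Phi s)%R} ->
  convex_function (`[0%R, +oo[%classic : set R) Phi ->
  {in `[0%R, +oo[ &, {homo Phi : s t / (s <= t)%R}} ->
  (Phi (fine (tv_dist (metropolis p q x) (Q x))))%:E <=
    (2^-1)%:E * (Phi (4 * fine (tv_dist (Qbar x) (Q x))))%:E +
    (2^-1)%:E * \int[Qbar x]_y (Phi (2 * `|q y x / qbar y x - 1|))%:E.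
Proof.
move=> hpi hQ hQbar rev Phi0 cPhi mPhi.
have [mp p0 _] := hpi; have [mq q0 QE] := hQ.
have [mqbar qbar0 QbarE] := hQbar.
have mratio := measurable_fun_pair1 x (measurable_ratio mq mqbar qbar0).
rewrite /= in mratio.
pose g y : R := (2 * `|q y x / qbar y x - 1|)%R.
have g0 y : (0 <= g y)%R by rewrite mulr_ge0.
have mg : measurable_fun setT g by exact: measurable_funM.
set t := fine (tv_dist (Qbar x) (Q x)); set tau := fine _.
have t0 : (0 <= t)%R by apply: fine_ge0; exact: tv_dist_ge0.
have tau0 : (0 <= tau)%R by apply: fine_ge0; exact: tv_dist_ge0.
pose I := \int[lebesgue d]_y
  (p y * qbar y x / p x * `|q y x / qbar y x - 1|)%:E.
have w0 y : (0 <= p y * qbar y x / p x * `|q y x / qbar y x - 1|)%R.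
  by rewrite mulr_ge0// divr_ge0 ?mulr_ge0// ltW.
have I0 : 0 <= I by apply: integral_ge0 => y _; rewrite lee_fin.
have IE : 2%:E * I = \int[Qbar x]_y (g y)%:E.
  rewrite (@ge0_integral_density _ _ _ (Qbar x) (lebesgue d) (qbar x))//; last first.
  - exact/measurable_EFinP.
  - exact: QbarE.
  - by move=> y; exact: ltW.
  - exact: (measurable_fun_pair2 x mqbar).
  rewrite -ge0_integralZl//; last 2 first.
  - apply/measurable_EFinP; apply: measurable_funM => //.
    apply: measurable_funM => //; apply: measurable_funM => //.
    exact: (measurable_fun_pair1 x mqbar).
  - by move=> y _; rewrite lee_fin.
  apply: eq_integral => y _; rewrite -!EFinM -rev; congr (_%:E).
  by rewrite /g/=; field; rewrite !gt_eqF.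
(* s is I when I is finite, and tau when it is infinite. *)
have [s s0 [sI taus]] : exists2 s : R, (0 <= s)%R &
    s%:E <= I /\ (tau <= 2 * t + s)%R.
  have tv_le := tv_dist_metropolis_le x hpi hQ hQbar rev.
  move: tv_le; rewrite -/I -(fineK (tv_dist_kernel_fin_num x hQ hQbar)) -/t.
  clear IE; case: I I0 => [r|_ _|//]; last first.
    by exists tau => //; split; [exact: leey|rewrite lerDr mulr_ge0].
  rewrite lee_fin => r0; rewrite -EFinD => le_r; exists r => //; split=> //.
  have : (tau <= t + r)%R; last by move=> ?; lra.
  move: (tv_dist_ge0 (metropolis p q x) (Q x)) le_r; rewrite /tau.
  by case: tv_dist => //= u _; rewrite lee_fin.
apply: (@le_trans _ _ (2^-1 * Phi (2 * (2 * t)) + 2^-1 * Phi (2 * s))%:E).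
  by rewrite lee_fin convex_le_half_double// mulr_ge0.
rewrite mulrA -natrM EFinD !EFinM leeD2l// lee_wpmul2l ?lee_fin ?invr_ge0//.
apply: (@jensen_le _ _ _ (Qbar x) Phi g) => //.
- exact: prob_kernel.
- exact: mulr_ge0.
- by rewrite -IE EFinM lee_wpmul2l// lee_fin.
Qed.

End metropolis.

Theorem theorem6 (R : realType) (d : nat)
    (pi : probability (euclid R d) R) (p : euclid R d -> R)
    (Q Qbar : R.-pker euclid R d ~> euclid R d)
    (q qbar : euclid R d -> euclid R d -> R)
    (hpi : positive_density pi p)
    (hQ : positive_kernel_density Q q)
    (hQbar : positive_kernel_density Qbar qbar)
    (hrev : reversible p qbar) :
  (forall x : euclid R d,
    tv_dist (metropolis p q x) (Q x) <=
      2%:E * tv_dist (Qbar x) (Q x) +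
      \int[lebesgue d]_y
        (p y * qbar y x / p x * `|q y x / qbar y x - 1|)%:E)
  /\
  (forall Phi : R -> R,
    {in `[0%R, +oo[, forall s, (0 <= Phi s)%R} ->
    convex_function (`[0%R, +oo[%classic : set R) Phi ->
    {in `[0%R, +oo[ &, {homo Phi : s t / (s <= t)%R}} ->
    forall (dW : measure_display) (W : measurableType dW)
      (P : probability W R) (X Y : {RV P >-> euclid R d}),
      (forall B, measurable B -> distribution P X B = pi B) ->
      conditional_law X Y Qbar ->
      'E_P[fun w => Phi (fine (tv_dist (metropolis p q (X w)) (Q (X w))))]
      <= (2^-1)%:E *
         'E_P[fun w => Phi (4 * fine (tv_dist (Qbar (X w)) (Q (X w))))%R]
       + (2^-1)%:E *
         'E_P[fun w => Phi (2 * `|q (X w) (Y w) / qbar (X w) (Y w) - 1|)%R]).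
Proof.
split=> [x|Phi Phi0 cPhi mPhi dW W P X Y Xpi XYQ].
  apply: (le_trans (tv_dist_metropolis_le x hpi hQ hQbar hrev)).
  by rewrite leeD2r// lee_pemull ?tv_dist_ge0// lee_fin ler1n.
have [mq q0 _] := hQ; have [mqbar qbar0 _] := hQbar.
have Phi_ge0 u : (0 <= u)%R -> (0 <= Phi u)%R.
  by move=> u0; apply: Phi0; rewrite in_itv/= u0.
pose t x := fine (tv_dist (Qbar x) (Q x)).
have t0 x : (0 <= t x)%R by apply: fine_ge0; exact: tv_dist_ge0.
have mt : measurable_fun setT t by exact: measurable_tv_dist_kernel hQ hQbar.
pose f (z : euclid R d * euclid R d) : \bar R :=
  (Phi (2 * `|q z.1 z.2 / qbar z.1 z.2 - 1|)%R)%:E.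
have mf : measurable_fun setT f.
  apply/measurable_EFinP; apply: measurable_comp_ge0_homo => //.
    by apply: measurable_funM => //; exact: measurable_ratio.
have f0 z : 0 <= f z by rewrite /f lee_fin Phi_ge0// mulr_ge0.
pose J x := \int[Qbar x]_y f (y, x).
have J0 x : 0 <= J x by apply: integral_ge0.
have mJ : measurable_fun setT J.
  apply: (@measurable_kfcomp _ _ _ _ _ Qbar (fun z => f (z.2, z.1))) => //.
  apply: (@measurableT_comp _ _ _ _ _ _ f setT (fun z => (z.2, z.1)) mf).
  exact: measurable_fun_pair.
have m4 : measurable_fun setT (fun x => (Phi (4 * t x))%:E).
  apply/measurable_EFinP.
  apply: (@measurable_comp_ge0_homo _ _ _ _ (fun x => (4 * t x)%R)) => //.
    exact: measurable_funM.
  by move=> x; rewrite mulr_ge0.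
have p4 x : 0 <= (Phi (4 * t x))%:E by rewrite lee_fin Phi_ge0// mulr_ge0.
have half0 : 0 <= (2^-1 : R)%:E by rewrite lee_fin invr_ge0.
have mJX : measurable_fun setT (fun w => J (X w)) by exact: measurableT_comp.
have m4X : measurable_fun setT (fun w => (Phi (4 * t (X w)))%:E).
  exact: (measurableT_comp m4).
rewrite !expectation.unlock.
apply: (@le_trans _ _ (\int[P]_w
    ((2^-1)%:E * (Phi (4 * t (X w)))%:E + (2^-1)%:E * J (X w)))).
  apply: ge0_le_integral_nonmeasurable => w; last first.
    exact: (Phi_tv_dist_metropolis_le (X w) hpi hQ hQbar hrev).
  by rewrite lee_fin Phi_ge0//; apply: fine_ge0; exact: tv_dist_ge0.
rewrite ge0_integralD//; first last.
- exact: emeasurable_funM.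
- by move=> w _; rewrite mule_ge0.
- exact: emeasurable_funM.
- by move=> w _; rewrite mule_ge0.
by rewrite !ge0_integralZl// (reversible_integral_swap hpi hQbar hrev Xpi XYQ).
Qed.
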